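(* Let $p$ be a prime, let $G$ be a finite $p$-group, and let $r=\mathrm{rk}\big(G'/(G'\cap \mathbf{Z}(G))\big)$. Then $\mathrm{rk}(G/\mathbf{Z}_2(G))\leq \frac{1}{2}(13r^2-r)$.
   Context: $G'$ is the derived (commutator) subgroup of $G$ and $\mathbf{Z}(G)$ its centre. $\mathbf{Z}_2(G)$ is the second member of the upper central series of $G$, i.e. $\mathbf{Z}_2(G)/\mathbf{Z}(G)=\mathbf{Z}(G/\mathbf{Z}(G))$. The rank $\mathrm{rk}(H)$ of a finite group $H$ is the minimal number $r$ such that every subgroup of $H$ can be generated by $r$ elements. *)

(* Defs.v *)
From mathcomp Require Import all_boot all_order all_algebra all_fingroup.
From mathcomp Require Import all_solvable.

Set Implicit Arguments.
Unset Strict Implicit.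
Unset Printing Implicit Defensive.

Local Open Scope group_scope.

(* Since 'm(K) is the least size of a generating set of K, 'm(K) <= r says
   that K can be generated by r elements. *)
Definition subgroups_gen_by (gT : finGroupType) (H : {set gT}) (r : nat) :=
  [forall K : {group gT}, (K \subset H) ==> ('m(K) <= r)].

Lemma subgroups_gen_by_ex (gT : finGroupType) (H : {set gT}) :
  exists r, subgroups_gen_by H r.
Proof.
exists #|gT|; apply/forallP=> K; apply/implyP=> _.
by rewrite -{1}(genGid K) (leq_trans (grank_min K)) ?max_card.
Qed.

(* Not the library's 'r(H), which only takes the elementary abelian
   subgroups of H into account. *)
Definition rk (gT : finGroupType) (H : {set gT}) : nat :=
  ex_minn (subgroups_gen_by_ex H).

Lemma rk_leP (gT : finGroupType) (H : {set gT}) (n : nat) :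
  reflect (forall K : {group gT}, K \subset H ->
             exists2 B : {set gT}, <<B>> = K & #|B| <= n)
          (rk H <= n).
Proof.
rewrite /rk; case: ex_minnP => r /forallP rP rmin; apply: (iffP idP).
  move=> le_rn K sKH; have [B genB cardB] := grank_witness K.
  exists B => //; rewrite cardB; apply: leq_trans le_rn.
  exact: (implyP (rP K)).
move=> genP; apply: rmin; apply/forallP=> K; apply/implyP=> sKH.
have [B genB cardB] := genP K sKH.
by rewrite -genB (leq_trans (grank_min B)).
Qed.

(* Main.v *)
Require Import Defs.
From mathcomp Require Import all_boot all_order all_algebra all_fingroup.
From mathcomp Require Import all_solvable.
From mathcomp Require Import zify.

Set Implicit Arguments.
Unset Strict Implicit.
Unset Printing Implicit Defensive.
Import GRing.Theory Num.Theory GroupScope.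

(** Let Z be the centre of G and r the rank of G' / (G' :&: Z).  To generate a
subgroup of G / Z_2(G), take its preimage S in G and descend from S to some
subgroup of Z_2(G) through a chain of subgroups, counting at each link the
elements that have to be added to climb back; gen_over n K S says that n of
them are enough.  The number of generators is at most the sum of these costs.

Most links are of one kind (comm_steps): if x |-> [x, a] sends S into M, and S
centralises M modulo N, this map induces a homomorphism from S to M / N, so its
kernel can be reached at cost rk (M / N).  The links are the following.

- First consider G / Z, with its normal subgroup N = G'Z / Z of rank at most r.
  Choose A normal abelian in N and self-centralising there.  Acting trivially
  on A / A^p costs r(r - 1)/2, the dimension of a group of unitriangular
  matrices (flag_cost); acting trivially on A / A^(p^2) costs r^2 more; and
  centralising A costs another r^2 (congr_cost), because a group of
  automorphisms of A which are congruent to 1 modulo p^2 behaves like a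
  congruence subgroup of GL_r over the p-adic integers, all of whose closed
  subgroups are topologically generated by r^2 elements.
- Elements centralising A have their commutators with N in C_N(A) <= A, so r^2
  further elements are enough to centralise N (normal_cost).
- Back in G, the subgroup obtained centralises G' modulo Z.  By Burnside's
  basis theorem G' is generated modulo Z by r commutators, and an element that
  commutes modulo Z with the 2r entries of these commutators centralises G'
  (centralizing_elements); the cost is 2r^2.
- Finally B = [C_G(G'), G] is an abelian subgroup of G', and r well-chosen
  elements g of G have a common centraliser in B that lies in Z
  (separating_elements_abelian).  An element x of C_G(G') with all [x, g] in Z
  then lies in Z_2(G) (mem_ucn2); the cost is r^2.

The sum is r(r - 1)/2 + 6r^2 = (13r^2 - r)/2. *)

(** * The rank *)

Lemma rk_gen (gT : finGroupType) (H K : {group gT}) :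
  K \subset H -> exists2 B : {set gT}, <<B>> = K & #|B| <= rk H.
Proof. by move=> sKH; have /rk_leP := leqnn (rk H); apply. Qed.

Lemma rkS (gT : finGroupType) (K H : {group gT}) :
  K \subset H -> rk K <= rk H.
Proof.
by move=> sKH; apply/rk_leP => L sLK; apply: rk_gen (subset_trans sLK sKH).
Qed.

Lemma rk_morphim (aT rT : finGroupType) (D H : {group aT})
    (f : {morphism D >-> rT}) :
  H \subset D -> rk (f @* H) <= rk H.
Proof.
move=> sHD; apply/rk_leP=> L sLfH.
have sfLH : H :&: f @*^-1 L \subset H by apply: subsetIl.
have [B genB cardB] := rk_gen sfLH.
have sBD : B \subset D.
  by rewrite (subset_trans _ sHD) // (subset_trans _ sfLH) // -genB subset_gen.
exists (f @* B); last first.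
  by apply: leq_trans cardB; rewrite morphimEsub // leq_imset_card.
by rewrite -morphim_gen // genB morphim_setIpre; apply/setIidPr.
Qed.

(** * Generation over a subgroup *)

Definition gen_over (gT : finGroupType) n (K S : {set gT}) :=
  exists2 B : {set gT}, #|B| <= n & K <*> B = S.

Section GenOver.
Variable gT : finGroupType.
Implicit Types K L S : {group gT}.

Lemma gen_over_leq m n K S : m <= n -> gen_over m K S -> gen_over n K S.
Proof. by move=> lemn [B cB gB]; exists B => //; apply: leq_trans lemn. Qed.

Lemma gen_over0 K : gen_over 0 K K.
Proof. by exists set0; rewrite ?cards0 // /joing setU0 genGid. Qed.

Lemma gen_over_trans m n K L S :
  gen_over m K L -> gen_over n L S -> gen_over (m + n) K S.
Proof.
case=> B cB gB [C cC gC]; exists (B :|: C).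
  by rewrite (leq_trans (leq_card_setU B C)) ?leq_add.
by rewrite -gC -gB -joingA; apply: esym (joing_idr _ _).
Qed.

Lemma gen_over_widen n K L S :
  K \subset L -> L \subset S -> gen_over n K S -> gen_over n L S.
Proof.
move=> sKL sLS [B cB gB]; exists B => //; apply/eqP; rewrite eqEsubset.
rewrite join_subG sLS -{1}gB joing_subr /=.
by rewrite -gB genS // setSU.
Qed.

Lemma leq_index_pgroup (p : nat) K S :
  p.-group S -> K \proper S -> p <= #|S : K|.
Proof.
move=> pS /andP[_]; rewrite -indexg_gt1 => iSK.
have /p_natP[[|k] ik] : p.-nat #|S : K| by apply: pnat_dvd (dvdn_indexg _ _) pS.
  by rewrite ik in iSK.
have p_gt0 : 0 < p by case: (p) ik iSK => [|//]; rewrite exp0n // => ->.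
by rewrite ik expnS leq_pmulr // expn_gt0 p_gt0.
Qed.

(** Adding an element outside K divides the index by at least p, and such an
element can be found in X as long as K does not contain X. *)
Lemma gen_over_index_in (p : nat) n K S (X : {set gT}) :
    p.-group S -> K <*> X = S -> #|S : K| <= p ^ n ->
  exists B : {set gT}, [/\ B \subset X, #|B| <= n & K <*> B = S].
Proof.
move=> pS gX; have sKS : K \subset S by rewrite -gX joing_subl.
elim: n K gX sKS => [|n IHn] K gX sKS iKS.
  exists set0; rewrite sub0set cards0 -[LHS]joing_idl /joing setU0 !genGid.
  split=> //.
  by apply/eqP; rewrite eqEsubset sKS -indexg_eq1 eqn_leq iKS indexg_gt0.
have [sXK | /subsetPn[x Xx notKx]] := boolP (X \subset K).
  exists set0; rewrite sub0set cards0 -gX; split=> //.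
  by rewrite /joing (setUidPl sXK) setU0.
pose L := (K <*> [set x])%G.
have sxX : [set x] \subset X by rewrite sub1set.
have gXL : L <*> X = S.
  rewrite -gX /= -joingA -[LHS]joing_idr /= [_ <*> X]/joing (setUidPr sxX).
  by rewrite !joing_idr.
have sLS : L \subset S by rewrite -gXL joing_subl.
have sKL : K \subset L by apply: joing_subl.
have iLS : #|S : L| <= p ^ n.
  rewrite -(leq_pmul2l (_ : 0 < #|L : K|)) ?indexg_gt0 // mulnC Lagrange_index //.
  apply: leq_trans iKS _; rewrite expnS leq_mul2r; apply/orP; right.
  apply: leq_index_pgroup (pgroupS sLS pS) _; rewrite properE sKL.
  by apply/subsetPn; exists x => //; rewrite mem_gen // !inE eqxx orbT.
have [B [sBX cB gB]] := IHn L gXL sLS iLS; exists (x |: B); split.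
- by rewrite subUset sxX.
- by rewrite (leq_trans (leq_card_setU _ _)) // cards1.
by rewrite -gB /= -joingA; apply: esym (joing_idr _ _).
Qed.

Lemma gen_over_index (p : nat) n K S :
  p.-group S -> K \subset S -> #|S : K| <= p ^ n -> gen_over n K S.
Proof.
move=> pS sKS iKS; have gS : K <*> S = S by apply/joing_idPr.
by have [B [_ cB gB]] := gen_over_index_in pS gS iKS; exists B.
Qed.

End GenOver.

(** Since L lies in the image of f, any preimages of the generators of f @* S
over L generate S over the full preimage of L, which contains the kernel. *)
Lemma gen_over_morphpre (aT rT : finGroupType) (S : {group aT})
    (f : {morphism S >-> rT}) (L : {group rT}) n :
  gen_over n L (f @* S) -> gen_over n (f @*^-1 L) S.
Proof.
case=> B cB gB; pose g b := repr (S :&: f @*^-1 [set b]).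
have sBfS : B \subset f @* S by rewrite -gB joing_subr.
have gP b : b \in B -> (g b \in S) /\ f (g b) = b.
  move/(subsetP sBfS)/morphimP=> [x Sx _ ->].
  have: g (f x) \in S :&: f @*^-1 [set f x].
    by apply: (mem_repr x); rewrite inE Sx mem_morphpre //= set11.
  by rewrite /g 3!inE => /and3P[-> _ /set1P].
have sgS : g @: B \subset S by apply/subsetP=> _ /imsetP[b /gP[? _] ->].
exists (g @: B); first by apply: leq_trans (leq_imset_card g B) cB.
have sLfS : L \subset f @* S by rewrite -gB joing_subl.
pose C := [set g b | b in B]; have sfL : f @*^-1 1 \subset f @*^-1 L <*> C.
  by rewrite (subset_trans _ (joing_subl _ _)) // morphpreS ?sub1G.
apply: (morphim_inj (f := f) (G := (f @*^-1 L <*> C)%G)); last rewrite [gval _]/=.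
- by rewrite join_subG subsetIl sgS sfL.
- by rewrite subsetIl subxx.
rewrite morphimY ?subsetIl // morphpreK // -[RHS]gB; congr (_ <*> _).
apply/setP=> b; apply/morphimP/idP=> [[_ _ /imsetP[c Bc ->] ->] | Bb].
  by have [_ ->] := gP c Bc.
by have [Sg fg] := gP b Bb; exists (g b); rewrite ?imset_f.
Qed.

Lemma gen_over_ker (aT rT : finGroupType) (S : {group aT})
    (f : {morphism S >-> rT}) (H : {group rT}) :
  f @* S \subset H -> gen_over (rk H) ('ker f) S.
Proof.
move/rk_gen=> [B gB cB]; apply: (gen_over_morphpre (L := 1%G)).
by exists B; rewrite // -[RHS]gB -[LHS]joing_idr /= joing1G.
Qed.

(** * Commutators with fixed elements *)

(** As [x y, a] = [x, a]^y [y, a], and conjugation by y is trivial on M modulo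
N, the map x |-> [x, a] N is a homomorphism; T is its kernel.  The bound on the
index serves in the counting argument of index_congr_Mho. *)
Lemma comm_step (gT : finGroupType) (S M N : {group gT}) (a : gT) :
    M \subset 'N(N) -> [~: M, S] \subset N -> {in S, forall x, [~ x, a] \in M} ->
  exists T : {group gT}, [/\ T \subset S, gen_over (rk (M / N)) T S,
    #|S : T| <= #|M / N| & {in T, forall x, [~ x, a] \in N}].
Proof.
move=> nNM cMS aP.
have fM : {in S &, {morph (fun x => coset N [~ x, a]) : x y / x * y}}.
  move=> x y Sx Sy; rewrite commMgJ conjg_mulR.
  have Mx := aP x Sx; have My := aP y Sy.
  have Nxy : [~ [~ x, a], y] \in N by rewrite (subsetP cMS) ?mem_commg.
  have nN := subsetP nNM; have nNxy := subsetP (normG N) _ Nxy.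
  by rewrite (morphM _ (groupM (nN _ Mx) nNxy) (nN _ My)) /= coset_kerr.
pose f := Morphism fM.
have sfM : f @* S \subset M / N.
  by apply/subsetP=> _ /morphimP[x _ Sx ->]; rewrite mem_quotient ?aP.
exists ('ker f)%G; split; first exact: subsetIl.
- exact: (gen_over_ker (f := f) (H := (M / N)%G)).
- by rewrite -{1}[S : {set _}]setIid -(card_morphim f) subset_leq_card.
by move=> x /morphpreP[Sx /set1P /coset_idr->] //; rewrite (subsetP nNM) ?aP.
Qed.

Lemma comm_steps (gT : finGroupType) (S M N : {group gT}) (s : seq gT) :
    M \subset 'N(N) -> [~: M, S] \subset N ->
    {in S & s, forall x a, [~ x, a] \in M} ->
  exists T : {group gT}, [/\ T \subset S, gen_over (size s * rk (M / N)) T S,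
    #|S : T| <= #|M / N| ^ size s & {in T & s, forall x a, [~ x, a] \in N}].
Proof.
move=> nNM; elim: s S => [|a s IHs] S cMS sP.
  by exists S; rewrite subxx indexgg; split=> //; apply: gen_over0.
have [|T [sTS genT iT Ta]] := comm_step (a := a) nNM cMS.
  by move=> x Sx; rewrite sP ?mem_head.
have cMT : [~: M, T] \subset N by rewrite (subset_trans (commgS _ sTS)).
have [|U [sUT genU iU Us]] := IHs T cMT.
  by move=> x b Tx sb; rewrite sP ?(subsetP sTS) // in_cons sb orbT.
exists U; split; first exact: subset_trans sTS.
- by rewrite /= mulSn addnC; apply: gen_over_trans genU genT.
- by rewrite -(Lagrange_index sTS sUT) expnS leq_mul.
move=> x b Ux; rewrite in_cons => /predU1P[-> | sb]; last exact: Us.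
by rewrite Ta ?(subsetP sUT).
Qed.

Lemma commg_gen_sub (gT : finGroupType) (X : {set gT}) (T W : {group gT}) :
    X \subset 'N(W) -> T \subset 'N(W) ->
  {in T & X, forall x b, [~ x, b] \in W} -> [~: <<X>>, T] \subset W.
Proof.
move=> nWX nWT cTX; rewrite -quotient_cents2 ?gen_subG //.
rewrite quotient_gen // gen_subG quotient_cents2 // commGC gen_subG.
by apply/subsetP=> _ /imset2P[x b Tx Xb ->]; apply: cTX.
Qed.

(** * Trivial action on a normal section *)

(** In the nilpotent group Q / W the nontrivial normal subgroup V / W meets the
centre; Z / W is a subgroup of order p of the intersection. *)
Lemma chief_step (gT : finGroupType) (p : nat) (Q W V : {group gT}) :
    p.-group Q -> W <| Q -> V <| Q -> W \proper V ->
  exists Z : {group gT}, [/\ Z <| Q, W \subset Z, Z \subset V,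
    #|Z : W| = p & [~: Z, Q] \subset W].
Proof.
move=> pQ nsWQ nsVQ /andP[sWV not_sVW].
have [[sWQ nWQ] [sVQ _]] := (andP nsWQ, andP nsVQ).
have pQW : p.-group (Q / W) by apply: quotient_pgroup.
have ntVW : V / W != 1.
  by rewrite -subG1 quotient_sub1 // (subset_trans sVQ).
have nsVW : V / W <| Q / W by apply: quotient_normal.
have ntD := meet_center_nil (pgroup_nil pQW) nsVW ntVW.
have pD : p.-group (V / W :&: 'Z(Q / W)).
  by apply: pgroupS pQW; rewrite subIset // normal_sub.
have [pr_p p_dvD _] := pgroup_pdiv pD ntD.
have [x Dx ox] := Cauchy pr_p p_dvD; have [Vx Zx] := setIP Dx.
have sxZ : <[x]> \subset 'Z(Q / W) by rewrite cycle_subG.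
have nsxQ : <[x]> <| Q / W by apply: sub_center_normal.
have eZ : coset W @*^-1 <[x]> / W = <[x]> by rewrite cosetpreK.
exists (coset W @*^-1 <[x]>)%G; split.
- by rewrite -(quotientGK nsWQ) cosetpre_normal.
- by rewrite -{1}(ker_coset W) kerE morphpreS ?sub1G.
- rewrite -(quotientGK (normalS sWV sVQ nsWQ)) cosetpreSK cycle_subG //.
- rewrite -card_quotient ?subsetIl //= cosetpreK -?orderE //.
rewrite -quotient_cents2 ?subsetIl //= eZ.
by rewrite (subset_trans sxZ) // subsetIr.
Qed.

Lemma rk_cyclic (gT : finGroupType) (C : {group gT}) : cyclic C -> rk C <= 1.
Proof.
move=> cycC; apply/rk_leP=> K sKC; have /cyclicP[x ->] := cyclicS sKC cycC.
by exists [set x]; rewrite ?cards1.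
Qed.

(** In a chief series of Q between W and V, the action of S on V / W is
unitriangular, whence the dimension 'C(n, 2).  By induction T may be assumed to
act trivially modulo Z, where Z / W is minimal; for the n generators v of V
over Z, the maps x |-> [x, v] from T to the group Z / W of order p then cost one
element each. *)
Lemma flag_cost (gT : finGroupType) (p n : nat) (Q S W V : {group gT}) :
    prime p -> p.-group Q -> S \subset Q -> W <| Q -> V <| Q -> W \subset V ->
    #|V : W| <= p ^ n ->
  exists T : {group gT}, [/\ T \subset S, gen_over 'C(n, 2) T S
    & [~: V, T] \subset W].
Proof.
move=> pr_p pQ sSQ; elim: n W => [|n IHn] W nsWQ nsVQ sWV iVW.
  exists S; split=> //; first exact: gen_over0.
  have sVW : V \subset W by rewrite -indexg_eq1 eqn_leq iVW indexg_gt0.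
  apply: subset_trans (commSg _ sVW) _.
  by rewrite commg_subl (subset_trans sSQ) ?normal_norm.
have [sVW | not_sVW] := boolP (V \subset W).
  exists S; split=> //; first exact: gen_over_leq (gen_over0 S).
  apply: subset_trans (commSg _ sVW) _.
  by rewrite commg_subl (subset_trans sSQ) ?normal_norm.
have prWV : W \proper V by rewrite properE sWV.
have [Z [nsZQ sWZ sZV iZW cZQ]] := chief_step pQ nsWQ nsVQ prWV.
have iVZ : #|V : Z| <= p ^ n.
  by rewrite -(leq_pmul2r (prime_gt0 pr_p)) -{1}iZW Lagrange_index // -expnSr.
have [T [sTS genT cVT]] := IHn Z nsZQ nsVQ sZV iVZ.
have [sVQ sZQ] := (normal_sub nsVQ, normal_sub nsZQ).
have nWQ := normal_norm nsWQ; have sTQ := subset_trans sTS sSQ.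
have [B cB gB] := gen_over_index (pgroupS sVQ pQ) sZV iVZ.
have sBV : B \subset V by rewrite -gB joing_subr.
have cZT : [~: Z, T] \subset W by rewrite (subset_trans (commgS _ sTQ)).
have [|||U [sUT genU _ cUB]] := @comm_steps _ T Z W (enum B).
- exact: subset_trans nWQ.
- by [].
- move=> x b Tx; rewrite mem_enum => Bb; rewrite (subsetP cVT) // commGC mem_commg //.
  exact: (subsetP sBV).
exists U; split; first exact: subset_trans sTS.
  apply: (gen_over_leq (m := n * 1 + 'C(n, 2))); first by rewrite binS bin1 muln1 addnC.
  apply: gen_over_trans genT; apply: gen_over_leq genU.
  rewrite leq_mul // -?cardE //; apply: rk_cyclic.
  by rewrite prime_cyclic // card_quotient ?iZW // (subset_trans sZQ).
rewrite -gB; apply: commg_gen_sub.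
- by rewrite (subset_trans _ nWQ) // subUset sZQ (subset_trans sBV).
- by rewrite (subset_trans (subset_trans sUT sTQ)).
move=> x b Ux /setUP[Zb | Bb]; last by rewrite cUB ?mem_enum.
by rewrite (subsetP cZT) // commGC mem_commg // (subsetP sUT).
Qed.

(** * Automorphisms congruent to 1 modulo p^2 *)

Lemma index_rk_exponent (gT : finGroupType) (p : nat) (V W : {group gT}) :
    prime p -> abelian V -> W \subset V -> {in V, forall x, x ^+ p \in W} ->
  #|V : W| <= p ^ rk V.
Proof.
move=> pr_p abV sWV VpW; have nWV := sub_abelian_norm abV sWV.
have abelE : p.-abelem (V / W).
  apply/(abelemP pr_p); split; first exact: quotient_abelian.
  move=> _ /morphimP[x nWx Vx ->].
  by rewrite -morphX //= coset_id ?VpW.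
rewrite -card_quotient // (card_pgroup (abelem_pgroup abelE)).
rewrite leq_exp2l ?prime_gt1 // -rank_abelem // -grank_abelian ?quotient_abelian //.
have [B gB cB] := rk_gen (subxx (V / W)).
rewrite -gB (leq_trans (grank_min B)) // (leq_trans cB) //.
by rewrite rk_morphim.
Qed.

(** In the abelian group V / W the n-th power map is a homomorphism; K is the
preimage of its kernel, so that its index counts the n-th powers. *)
Lemma index_powers (gT : finGroupType) (n : nat) (V W : {group gT}) :
    V \subset 'N(W) -> [~: V, V] \subset W ->
  exists K : {group gT}, [/\ K \subset V,
    {in V, forall x, (x \in K) = (x ^+ n \in W)}
    & #|V : K| = #|[set coset W (x ^+ n) | x in V]|].
Proof.
move=> nWV cVW.
have fM : {in V &, {morph (fun x => coset W (x ^+ n)) : x y / x * y}}.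
  move=> x y Vx Vy; have nW := subsetP nWV.
  rewrite !(morphX, morphM) ?groupM ?nW //= expgMn //.
  apply: (centsP _ (coset W x) _ (coset W y)); last 2 first.
  - exact: (mem_quotient W Vx).
  - exact: (mem_quotient W Vy).
  by rewrite quotient_cents2.
pose f := Morphism fM; exists ('ker f)%G; split; first exact: subsetIl.
  move=> x Vx; apply/(kerP f Vx)/idP=> [fx1 | Wx]; last exact: coset_id.
  by apply: coset_idr fx1; rewrite groupX ?(subsetP nWV).
by rewrite -{1}[V : {set _}]setIid -(card_morphim f) morphimEdom.
Qed.

(** The elements of S that act trivially on A / M.  Encoding them through the
quotient provides the group structure. *)
Definition centmod (gT : finGroupType) (S A M : {group gT}) : {group gT} :=
  (S :&: coset M @*^-1 'C(A / M))%G.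

Lemma centmodP (gT : finGroupType) (S A M : {group gT}) (x : gT) :
    A \subset 'N(M) -> S \subset 'N(M) ->
  reflect (x \in S /\ {in A, forall a, [~ a, x] \in M}) (x \in centmod S A M).
Proof.
move=> nMA nMS; rewrite /= in_setI; case Sx: (x \in S); last by right; case.
have nMx := subsetP nMS x Sx.
rewrite /= morphpreE in_setI nMx inE /=.
apply: (iffP centP) => [cAx | [_ cAx] _ /morphimP[a nMa Aa ->]].
  split=> // a Aa; have nMa := subsetP nMA a Aa.
  apply: coset_idr; first by rewrite groupR.
  rewrite morphR //; apply/eqP/commgP/commute_sym/cAx.
  exact: mem_quotient.
apply/commute_sym/commgP; rewrite -morphR //= coset_id ?cAx //.
Qed.

(** H k is the analogue, for the automorphisms of A induced by S, of the
congruence subgroup of level p^k; M k is A^(p^k). *)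
Section CongruenceSubgroups.
Variables (gT : finGroupType) (p : nat) (A S : {group gT}).
Hypotheses (pr_p : prime p) (pA : p.-group A) (abA : abelian A).
Hypothesis nAS : S \subset 'N(A).
Let M k := ('Mho^k(A))%G.
Let H k := centmod S A (M k).

Lemma MhoP k x :
  reflect (exists2 a, a \in A & x = a ^+ (p ^ k)) (x \in 'Mho^k(A)).
Proof. by rewrite (MhoEabelian k pA abA); apply: imsetP. Qed.

Lemma normA_Mho k : A \subset 'N(M k).
Proof. exact: normal_norm (Mho_normal k A). Qed.

Lemma norm_Mho k : S \subset 'N(M k).
Proof. exact: char_norm_trans (Mho_char k A) nAS. Qed.

Lemma congrP k x :
  reflect (x \in S /\ {in A, forall a, [~ a, x] \in M k}) (x \in H k).
Proof. by apply: centmodP; [apply: normA_Mho | apply: norm_Mho]. Qed.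

Lemma congr_leq j k : j <= k -> H k \subset H j.
Proof.
move=> lejk; apply/subsetP=> x /congrP[Sx cAx]; apply/congrP; split=> // a Aa.
by rewrite (subsetP (Mho_leq A lejk)) ?cAx.
Qed.

Lemma Mho_expgn j k x : x \in M j -> x ^+ (p ^ k) \in M (j + k).
Proof.
case/MhoP=> a Aa ->; apply/MhoP; exists a => //.
by rewrite -expgM -expnD.
Qed.

(** Because A is abelian, [a^n, x] = [a, x]^n: the subgroup of level k raises
the M filtration by k. *)
Lemma commg_Mho_congr j k m x : m \in M j -> x \in H k -> [~ m, x] \in M (j + k).
Proof.
case/MhoP=> a Aa -> /congrP[Sx cAx].
rewrite commXg; first by rewrite addnC Mho_expgn ?cAx.
apply: (centsP abA) => //; rewrite -/(M 0).
by have := cAx a Aa; apply: subsetP (Mho_sub k A) _.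
Qed.

(** Writing x = 1 + u in additive notation, u maps A into M k and u^2 maps A into
M (k + k), so x^n = 1 + n u modulo M (k + k). *)
Lemma commg_congr_expgn k n a x : a \in A -> x \in H k ->
  [~ a, x] ^- n * [~ a, x ^+ n] \in M (k + k).
Proof.
move=> Aa Hx; have [Sx cAx] := congrP k x Hx; set u := [~ a, x].
have Mu : u \in M k by apply: cAx.
elim: n => [|n IHn]; first by rewrite commg1 invg1 mulg1 group1.
set m := _ * _ in IHn; have Em : [~ a, x ^+ n] = u ^+ n * m by rewrite /m mulKVg.
have -> : [~ a, x ^+ n.+1] = u * (u ^+ n * m) ^ x by rewrite expgSr commgMJ Em.
have aux (v w y : gT) : (v * w) ^- 1 * (v * (w * m) ^ y) = [~ w, y] * m ^ y.
  by rewrite conjMg commgEl expg1 invMg -!mulgA mulKg.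
rewrite expgS -[_^-1]/((_ * _) ^- 1) aux.
rewrite groupM // ?commg_Mho_congr ?groupX //.
by rewrite memJ_norm // (subsetP (norm_Mho _)).
Qed.

Lemma Mho_expgp k m : m \in M k -> m ^+ p \in M k.+1.
Proof. by move=> Mm; rewrite -addn1 -{1}(expn1 p) Mho_expgn. Qed.

Lemma congr_expgp k x : 0 < k -> x \in H k -> x ^+ p \in H k.+1.
Proof.
move=> k_gt0 Hx; have [Sx cAx] := congrP k x Hx.
apply/congrP; split=> [|a Aa]; first exact: groupX.
rewrite -(mulKVg ([~ a, x] ^+ p) [~ a, x ^+ p]) groupM ?Mho_expgp ?cAx //.
apply: subsetP (commg_congr_expgn p Aa Hx); apply: Mho_leq.
by rewrite -addn1 leq_add2l.
Qed.

(** For x = 1 + u and y = 1 + v of level k, both products xy and yx are congruent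
to 1 + u + v modulo level k + k. *)
Lemma commg_congr k : [~: H k, H k] \subset H (k + k).
Proof.
rewrite gen_subG; apply/subsetP=> _ /imset2P[x y Hx Hy ->].
have [[Sx cAx] [Sy cAy]] := (congrP k x Hx, congrP k y Hy).
apply/congrP; split=> [|b Ab]; first by rewrite groupR.
pose a := b ^ (y * x)^-1; have Eb : b = a ^ (y * x) by rewrite conjgKV.
have Aa : a \in A by rewrite memJ_norm // (subsetP nAS) ?groupV ?groupM.
pose u := [~ a, x]; pose v := [~ a, y].
have Exy : a ^ (x * y) = a * (v * u) * [~ u, y].
  by rewrite conjg_mulR commgMJ (conjg_mulR u) !mulgA.
have Eyx : a ^ (y * x) = a * (v * u) * [~ v, x].
  have -> : v * u = u * v.
    by apply: (centsP abA); apply: (subsetP (Mho_sub k A)); [apply: cAy | apply: cAx].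
  by rewrite conjg_mulR commgMJ (conjg_mulR v) !mulgA.
rewrite commgEl {2}Eb -conjgM -commgC Eb Exy Eyx invMg -mulgA mulKg.
by rewrite groupM ?groupV ?commg_Mho_congr ?cAx ?cAy.
Qed.

Lemma normM_Mho j k : M j \subset 'N(M k).
Proof. exact: subset_trans (Mho_sub j A) (normA_Mho k). Qed.

Lemma Mho_trivial k : logn p #|A| <= k -> M k = 1%G.
Proof.
move=> le_k; apply/val_inj/trivgP/subsetP=> _ /MhoP[a Aa ->].
rewrite inE -order_dvdn -(subnKC le_k) expnD -card_pgroup //.
by rewrite dvdn_mulr ?order_dvdG.
Qed.

(** The p-th power map sends M k / M k.+1 onto M k.+1 / M k.+2, and N / M k.+1
is its kernel. *)
Lemma index_Mho_powers k : exists N : {group gT}, [/\ M k.+1 \subset N,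
  {in M k, forall m, (m \in N) = (m ^+ p \in M k.+2)}, N \subset M k
  & #|N : M k.+1| * #|M k.+1 : M k.+2| <= #|M k : M k.+1|].
Proof.
have cM : [~: M k, M k] \subset M k.+2.
  by rewrite (commG1P (abelianS (Mho_sub k A) abA)) sub1G.
have [N [sNM NP iN]] := index_powers p (normM_Mho k k.+2) cM.
have sMN : M k.+1 \subset N.
  apply/subsetP=> m Mm; rewrite NP ?Mho_expgp //.
  exact: subsetP (Mho_leq A (leqnSn k)) _ Mm.
exists N; split=> //; rewrite mulnC -(Lagrange_index sNM sMN) leq_mul //.
rewrite iN -card_quotient ?normM_Mho //; apply/subset_leq_card/subsetP.
move=> _ /morphimP[_ _ /MhoP[a Aa ->] ->].
apply/imsetP; exists (a ^+ (p ^ k)); first by apply/MhoP; exists a.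
by rewrite -expgM -expnSr.
Qed.

Lemma congr_sub k : H k \subset S. Proof. exact: subsetIl. Qed.

Lemma norm_congr k : S \subset 'N(H k).
Proof.
apply/normsP=> y Sy; apply/normP; rewrite inE; apply/subsetP=> _ /imsetP[x Hx ->].
have [Sx cAx] := congrP k x Hx; apply/congrP; split=> [|a Aa]; first exact: groupJ.
rewrite -(conjgKV y a) -conjRg memJ_norm ?(subsetP (norm_Mho k)) // cAx //.
by rewrite memJ_norm // groupV (subsetP nAS).
Qed.

(** The p-th power map induces a homomorphism from H k to H k.+1 / H k.+2 with
kernel K / H k.+2; its image lies in the image of F. *)
Lemma index_congr_powers (F : {group gT}) k :
    1 < k -> {in S, forall x, x ^+ p \in F} ->
  exists K : {group gT}, [/\ K \subset H k,
    {in H k, forall x, (x \in K) = (x ^+ p \in H k.+2)}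
    & #|H k : K| * #|F :&: H k.+2| <= #|F :&: H k.+1|].
Proof.
move=> k_gt1 FpS.
have nH j i : H j \subset 'N(H i) := subset_trans (congr_sub j) (norm_congr i).
have cH : [~: H k, H k] \subset H k.+2.
  by rewrite (subset_trans (commg_congr k)) // congr_leq // -addn2 leq_add2l.
have [K [sKH KP iK]] := index_powers p (nH k k.+2) cH.
exists K; split=> //; rewrite -(LagrangeI (F :&: H k.+1) (H k.+2)) mulnC -setIA.
rewrite (setIidPr (congr_leq (leqnSn _))) leq_mul // iK -card_quotient; last first.
  by rewrite subIset // nH orbT.
apply/subset_leq_card/subsetP=> _ /imsetP[x Hx ->].
apply: mem_quotient; rewrite inE FpS ?(subsetP (congr_sub k)) //=.
by rewrite congr_expgp // ltnW.
Qed.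

(** An element of K modulo H k.+1 is determined by the commutators of rk A
generators of A with it, which lie in N modulo M k.+1. *)
Lemma index_congr_Mho (N K : {group gT}) k :
    0 < k -> N \subset M k -> K \subset H k ->
    {in K & A, forall x a, [~ a, x] \in N} ->
  #|K| <= #|H k.+1| * #|N : M k.+1| ^ rk A.
Proof.
move=> k_gt0 sNM sKH KA.
have [X genX cX] := rk_gen (subxx A).
have sXA : X \subset A by rewrite -genX subset_gen.
have nMN := subset_trans sNM (normM_Mho k k.+1).
have sKS := subset_trans sKH (congr_sub k).
have [||T [sTK _ iT cTX]] := @comm_steps _ K N (M k.+1) (enum X) nMN.
- rewrite gen_subG; apply/subsetP=> _ /imset2P[m x Nm Kx ->].
  apply: (subsetP (Mho_leq A (_ : k.+1 <= k + k))); first by rewrite -addn1 leq_add2l.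
  by apply: commg_Mho_congr; [apply: subsetP Nm | apply: subsetP Kx].
- move=> x a Kx; rewrite mem_enum => Xa.
  by rewrite -groupV invg_comm KA // (subsetP sXA).
have sTH : T \subset H k.+1.
  apply/subsetP=> x Tx; apply/congrP; split=> [|a Aa].
    by rewrite (subsetP sKS) // (subsetP sTK).
  have sAT : [~: <<X>>, T] \subset M k.+1.
    apply: commg_gen_sub => [||y b Ty Xb]; last by rewrite cTX ?mem_enum.
      exact: subset_trans sXA (normA_Mho _).
    exact: subset_trans (subset_trans sTK sKS) (norm_Mho _).
  by rewrite (subsetP sAT) // mem_commg ?genX.
rewrite -(Lagrange sTK) leq_mul ?subset_leq_card //.
rewrite (leq_trans iT) // card_quotient // leq_pexp2l ?indexg_gt0 //.
by rewrite -cardE.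
Qed.

(** If M k / M k.+1 has dimension d_k and A has rank d, the quotient of H k by
H k.+1 embeds in Hom(A, M k / M k.+1), which has dimension d * d_k.  The part
which is not killed by the p-th power map reappears as p-th powers, hence inside
F, one level further; the part that is killed maps A into the kernel N / M k.+1
of multiplication by p, of dimension at most d_k - d_(k+1).  Summing over all
levels from k on, the dimensions d * (d_k - d_(k+1)) telescope to d * d_k.  The
condition 1 < k makes 2k at least k + 2, so that p-th powers are governed by
the linear terms alone, even for p = 2. *)
Lemma card_congr_leq (F : {group gT}) k :
    1 < k -> {in S, forall x, x ^+ p \in F} -> 'C_S(A) \subset F ->
  #|H k| <= #|F :&: H k.+1| * #|M k : M k.+1| ^ rk A.
Proof.
move=> k_gt1 FpS sCF; have [j] := ubnPleq (logn p #|A| - k).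
elim: j k k_gt1 => [|j IHj] k k_gt1.
  (* M k is trivial, so H k centralises A and lies in F. *)
  rewrite leqn0 subn_eq0 => le_k.
  rewrite -[X in X <= _]muln1 leq_mul ?expn_gt0 ?indexg_gt0 //.
  apply/subset_leq_card/subsetP=> x Hx; have [Sx cAx] := congrP k x Hx.
  have cAx1 : {in A, forall a, [~ a, x] = 1}.
    by move=> a /cAx; rewrite Mho_trivial // => /set1P.
  apply/setIP; split; last by apply/congrP; split=> // a /cAx1->.
  apply: (subsetP sCF); rewrite in_setI Sx /=.
  by apply/centP=> a /cAx1/eqP/commgP/commute_sym.
rewrite leq_subLR -addSnnS -leq_subLR => le_j; have {}IHj := IHj k.+1 (ltnW k_gt1) le_j.
have [N [sMN NP sNM iN]] := index_Mho_powers k.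
have [K [sKH KP iK]] := index_congr_powers k_gt1 FpS.
have k_gt0 := ltnW k_gt1.
(* [a, x]^p is [a, x^p] modulo M (k + k), and x^p has level k + 2. *)
have cK : #|K| <= #|H k.+1| * #|N : M k.+1| ^ rk A.
  apply: index_congr_Mho => // x a Kx Aa; have Hx := subsetP sKH x Kx.
  have [Sx cAx] := congrP k x Hx; rewrite NP ?cAx //.
  have Hxp : x ^+ p \in H k.+2 by rewrite -KP.
  have [_ cAxp] := congrP _ _ Hxp.
  have sM : 'Mho^(k + k)(A) \subset 'Mho^k.+2(A).
    by apply: Mho_leq; rewrite -addn2 leq_add2l.
  have := subsetP sM _ (commg_congr_expgn p Aa Hx).
  by rewrite groupMr ?cAxp // groupV.
rewrite -(Lagrange sKH) (leq_trans (leq_mul cK (leqnn _))) //.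
apply: leq_trans (leq_mul (leq_mul IHj (leqnn _)) (leqnn _)) _.
rewrite mulnC -[X in _ * X <= _]mulnA mulnA [X in _ * X <= _]mulnC.
apply: leq_trans (leq_mul iK (leqnn _)) _.
by rewrite leq_mul // -expnMn; case: (rk A) => // d; rewrite leq_exp2r.
Qed.

(** Apply card_congr_leq to F = Phi(S) C_S(A), which contains all p-th powers of
S and therefore has index at most p^(d^2); Phi(S) consists of non-generators
and can be dropped. *)
Lemma congr_cost :
    p.-group S -> [~: A, S] \subset 'Mho^2(A) ->
  gen_over (rk A * rk A) 'C_S(A) S.
Proof.
move=> pS cAS; pose F := ('Phi(S) <*> 'C_S(A))%G.
have sFS : F \subset S by rewrite join_subG Phi_sub subsetIl.
have FpS : {in S, forall x, x ^+ p \in F}.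
  move=> x Sx; apply: (subsetP (joing_subl _ _)).
  rewrite /= (Phi_joing pS); apply: (subsetP (joing_subr _ _)).
  by rewrite -(expn1 p); apply: Mho_p_elt => //; apply: mem_p_elt pS Sx.
have sSH : S \subset H 2.
  apply/subsetP=> x Sx; apply/congrP; split=> // a Aa.
  by rewrite (subsetP cAS) ?mem_commg.
have pr2 : #|M 2 : M 3| <= p ^ rk A.
  apply: leq_trans (index_rk_exponent pr_p _ _ _) _.
  - exact: abelianS (Mho_sub 2 A) abA.
  - exact: Mho_leq.
  - by move=> x; apply: Mho_expgp.
  by rewrite leq_exp2l ?prime_gt1 // rkS ?Mho_sub.
have iF : #|S : F| <= p ^ (rk A * rk A).
  rewrite -(leq_pmul2l (cardG_gt0 F)) Lagrange //.
  apply: leq_trans (subset_leq_card sSH) _.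
  apply: leq_trans (card_congr_leq (isT : 1 < 2) FpS (joing_subr _ _)) _.
  rewrite leq_mul ?subset_leq_card ?subsetIl // expnM.
  by case: (rk A) pr2 => // d pr2; rewrite leq_exp2r.
have [B cB gB] := gen_over_index pS sFS iF.
exists B => //; apply: Phi_nongen; rewrite -[LHS]joing_idr.
by rewrite -[RHS]gB; apply: joingA.
Qed.

End CongruenceSubgroups.

(** * Centralising a normal subgroup *)

(** The three summands come from flag_cost, applied to A / A^p, from the
homomorphisms x |-> [x, a] to A^p / A^(p^2) for the generators a of A, and from
congr_cost. *)
Lemma abelian_cost (gT : finGroupType) (p : nat) (Q S A : {group gT}) :
    prime p -> p.-group Q -> S \subset Q -> A <| Q -> abelian A ->
  gen_over ('C(rk A, 2) + 2 * rk A ^ 2) 'C_S(A) S.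
Proof.
move=> pr_p pQ sSQ nsAQ abA; have [sAQ nAQ] := andP nsAQ.
have pA := pgroupS sAQ pQ; have nAS := subset_trans sSQ nAQ.
pose M k := ('Mho^k(A))%G.
have nsMQ k : M k <| Q := char_normal_trans (Mho_char k A) nsAQ.
have iA : #|A : M 1%N| <= p ^ rk A.
  apply: index_rk_exponent => //; first exact: Mho_sub.
  by move=> x Ax; apply: (Mho_expgp pA abA (k := 0)); rewrite /= Mho0.
have [T [sTS genT cAT]] := flag_cost pr_p pQ sSQ (nsMQ 1%N) nsAQ (Mho_sub 1 A) iA.
have sTQ := subset_trans sTS sSQ; have nAT := subset_trans sTQ nAQ.
have [X genX cX] := rk_gen (subxx A).
have sXA : X \subset A by rewrite -genX subset_gen.
have cTM x a : x \in T -> a \in A -> [~ x, a] \in M 1%N.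
  by move=> Tx Aa; rewrite (subsetP cAT) // commGC mem_commg.
have nMM : M 1%N \subset 'N(M 2).
  by rewrite (subset_trans (normal_sub (nsMQ 1%N))) // normal_norm.
have [||U [sUT genU _ cUX]] := @comm_steps _ T (M 1%N) (M 2) (enum X) nMM.
- rewrite gen_subG; apply/subsetP=> _ /imset2P[m x Mm Tx ->].
  apply: (commg_Mho_congr pA abA nAT (j := 1%N) (k := 1%N)) => //.
  by apply/congrP => //; split=> // a Aa; rewrite -groupV invg_comm cTM.
- by move=> x a Tx; rewrite mem_enum => Xa; rewrite cTM ?(subsetP sXA).
have sUQ := subset_trans sUT sTQ.
have cAU : [~: A, U] \subset M 2.
  rewrite -{1}genX; apply: commg_gen_sub => [||x a Ux Xa].
  - by rewrite (subset_trans sXA) ?(subset_trans sAQ) ?normal_norm.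
  - by rewrite (subset_trans sUQ) ?normal_norm.
  by rewrite cUX ?mem_enum.
have genC := congr_cost pr_p pA abA (subset_trans sUQ nAQ) (pgroupS sUQ pQ) cAU.
apply: (@gen_over_widen _ _ ('C_U(A)) ('C_S(A)) S).
- by rewrite setSI // (subset_trans sUT).
- exact: subsetIl.
have genU' : gen_over (rk A * rk A) U T.
  apply: gen_over_leq genU; rewrite -cardE leq_mul //.
  by apply: leq_trans (rk_morphim _ nMM) _; rewrite rkS ?Mho_sub.
apply: gen_over_leq (gen_over_trans genC (gen_over_trans genU' genT)).
by rewrite addnA addnC mul2n -addnn -mulnn.
Qed.

(** A is maximal among the abelian normal subgroups of Q in N.  Were C_N(A)
larger, it would contain a normal subgroup Z of Q with Z / A of order p; as A
is central in Z, this Z would be abelian. *)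
Lemma self_centralizing_abelian (gT : finGroupType) (p : nat) (Q N : {group gT}) :
    prime p -> p.-group Q -> N <| Q ->
  exists A : {group gT}, [/\ A <| Q, abelian A, A \subset N & 'C_N(A) \subset A].
Proof.
move=> pr_p pQ nsNQ; have [sNQ nNQ] := andP nsNQ.
pose P (A : {group gT}) := [&& A <| Q, abelian A & A \subset N].
have P1 : P 1%G by rewrite /P normal1 abelian1 sub1G.
have [A maxA _] := maxgroup_exists P1.
case/maxgroupP: maxA => /and3P[nsAQ abA sAN] maxA.
exists A; split=> //; apply: contraT => not_sCA.
pose C := 'C_N(A)%G.
have nsCQ : C <| Q.
  by rewrite /normal subIset ?sNQ //= normsI // norms_cent // normal_norm.
have prAC : A \proper C.
  by rewrite properE not_sCA subsetI sAN [_ \subset 'C(_)]abA.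
have [Z [nsZQ sAZ sZC iZA cZQ]] := chief_step pQ nsAQ nsCQ prAC.
have abZ : abelian Z.
  apply: (cyclic_factor_abelian (H := A)).
    by rewrite subsetI sAZ centsC (subset_trans sZC) ?subsetIr.
  rewrite prime_cyclic // card_quotient ?iZA //.
  by rewrite (subset_trans (normal_sub nsZQ)) ?normal_norm.
have PZ : P Z by rewrite /P nsZQ abZ (subset_trans sZC) ?subsetIl.
have := maxA Z PZ sAZ => eZA.
by have := prime_gt1 pr_p; rewrite -iZA eZA indexgg.
Qed.

(** If x in S centralises A and n is in N, then [x, n] = x^-1 x^n centralises A
as well, since A is normal; so it lies in C_N(A), that is, in A. *)
Lemma normal_cost (gT : finGroupType) (p : nat) (Q S N : {group gT}) :
    prime p -> p.-group Q -> S \subset Q -> N <| Q ->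
  gen_over ('C(rk N, 2) + 3 * rk N ^ 2) 'C_S(N) S.
Proof.
move=> pr_p pQ sSQ nsNQ.
have [A [nsAQ abA sAN sCA]] := self_centralizing_abelian pr_p pQ nsNQ.
have leAN : rk A <= rk N by apply: rkS.
have genT := abelian_cost pr_p pQ sSQ nsAQ abA.
have [X genX cX] := rk_gen (subxx N).
have sXN : X \subset N by rewrite -genX subset_gen.
have nCQ : Q \subset 'N('C(A)) by rewrite norms_cent ?normal_norm.
have sTQ : 'C_S(A) \subset Q by rewrite subIset ?sSQ.
have nA1 : A \subset 'N(1%G) by apply: norms1.
have [||U [sUT genU _ cUX]] := @comm_steps _ 'C_S(A)%G A 1%G (enum X) nA1.
- by apply/trivgP/commG1P; rewrite centsC subsetIr.
- move=> x n Tx; rewrite mem_enum => Xn; have Nn := subsetP sXN n Xn.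
  have Qn := subsetP (normal_sub nsNQ) n Nn; have [Sx cAx] := setIP Tx.
  apply: (subsetP sCA); apply/setIP; split.
    rewrite commgEr groupM ?memJ_norm ?groupV //.
    by rewrite (subsetP (normal_norm nsNQ)) ?(subsetP sSQ).
  by rewrite commgEl groupM ?groupV // memJ_norm // (subsetP nCQ).
have cUN : U \subset 'C(N).
  rewrite centsC -genX gen_subG centsC; apply/centsP=> x Ux n Xn.
  by apply/commgP; rewrite -in_set1 cUX ?mem_enum.
apply: (@gen_over_widen _ _ U ('C_S(N)) S).
- by rewrite subsetI cUN (subset_trans sUT) ?subsetIl.
- exact: subsetIl.
have genU' : gen_over (rk N * rk N) U 'C_S(A).
  apply: gen_over_leq genU; rewrite -cardE leq_mul //.
  exact: leq_trans (rk_morphim _ nA1) leAN.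
apply: gen_over_leq (gen_over_trans genU' genT).
rewrite addnCA leq_add ?leq_bin2l // mulnn (mulSn 2) leq_add2l leq_mul2l.
by case: (rk N) leAN => [|d] le; rewrite ?leq_exp2r //; case: (rk A) le.
Qed.

(** * Centralising the derived subgroup *)

Lemma Burnside_basis_rk (gT : finGroupType) (p : nat) (P : {group gT})
    (X : {set gT}) :
    prime p -> p.-group P -> <<X>> = P ->
  exists Y : {set gT}, [/\ Y \subset X, #|Y| <= rk P & <<Y>> = P].
Proof.
move=> pr_p pP genX; have sXP : X \subset P by rewrite -genX subset_gen.
have gX : 'Phi(P) <*> X = P.
  by rewrite -[LHS]joing_idr genX; apply/joing_idPr/Phi_sub.
have /(abelemP pr_p)[abQ xQ] := Phi_quotient_abelem pP.
have iP : #|P : 'Phi(P)| <= p ^ rk P.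
  rewrite -card_quotient ?gFnorm // -indexg1.
  apply: leq_trans (index_rk_exponent pr_p _ (sub1G _) _) _.
  - exact: abQ.
  - by move=> x Px; rewrite xQ // group1.
  by rewrite leq_exp2l ?prime_gt1 // rk_morphim // gFnorm.
have [Y [sYX cY gY]] := gen_over_index_in pP gX iP.
by exists Y; split=> //; apply: Phi_nongen.
Qed.

Lemma gen_over_cosetpre (gT : finGroupType) n (S Z : {group gT})
    (L : {group coset_of Z}) :
  S \subset 'N(Z) -> gen_over n L (S / Z) -> gen_over n (S :&: coset Z @*^-1 L) S.
Proof.
move=> nZS genL; have [f [_ _ fV fI]] := restrmP (coset_morphism Z) nZS.
by rewrite -fV; apply: gen_over_morphpre; rewrite fI.
Qed.

(** As long as the elements of V that commute with the chosen ones are not all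
central, some g in G fails to commute with one of them; adding g reduces the
order of what remains by a factor of at least p. *)
Lemma separating_elements (gT : finGroupType) (p n : nat) (G V : {group gT}) :
    p.-group G -> V \subset G -> #|V : 'Z(G)| <= p ^ n ->
  exists s : seq gT, [/\ size s <= n, {subset s <= G} &
    {in V, forall x, {in s, forall g, commute x g} -> x \in 'Z(G)}].
Proof.
move=> pG; elim: n V => [|n IHn] V sVG iV.
  exists [::]; split=> // x Vx _; apply: subsetP Vx.
  by rewrite -indexg_eq1 eqn_leq iV indexg_gt0.
have [sVZ | /subsetPn[v Vv notZv]] := boolP (V \subset 'Z(G)).
  by exists [::]; split=> // x Vx _; apply: subsetP Vx.
have [g Gg not_cvg] : exists2 g, g \in G & g \notin 'C[v].
  apply/subsetPn; apply: contra notZv => sGC.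
  by rewrite inE (subsetP sVG) //= -sub_cent1.
pose U := 'C_V[g]%G; have sUV : U \subset V by apply: subsetIl.
have prUV : U \proper V.
  rewrite properE sUV; apply/subsetPn; exists v => //.
  by rewrite in_setI Vv /= cent1C.
have UZ : U :&: 'Z(G) = V :&: 'Z(G).
  rewrite setIAC; apply/setIidPl/subsetP=> z /setIP[_ /setIP[_ /centP cGz]].
  exact/cent1P/cGz.
have iU : #|U : 'Z(G)| <= p ^ n.
  have p_gt0 : 0 < p.
    by rewrite lt0n; apply: contraTneq iV => ->; rewrite exp0n // leqNgt indexg_gt0.
  rewrite -(leq_pmul2l p_gt0) -expnS (leq_trans _ iV) //.
  have eU := LagrangeI U 'Z(G); have eV := LagrangeI V 'Z(G); rewrite UZ in eU.
  rewrite -(leq_pmul2l (cardG_gt0 (V :&: 'Z(G)))) mulnCA /= eU eV.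
  rewrite mulnC -[in X in _ <= X](Lagrange sUV) leq_mul //.
  exact: leq_index_pgroup (pgroupS sVG pG) prUV.
have [s [cs sG sP]] := IHn U (subset_trans sUV sVG) iU.
exists (g :: s); split=> // [h | x Vx cx].
  by rewrite in_cons => /predU1P[-> | /sG].
apply: sP => [|h sh]; last by apply: cx; rewrite in_cons sh orbT.
by rewrite inE Vx /=; apply/cent1P/cx/mem_head.
Qed.

(** It is enough to separate the elements x with x^p central: if x commutes with
the chosen elements then so do its powers, and a non-central x has a non-central
power whose p-th power is central.  Modulo the centre those x form an elementary
abelian group, so their number is bounded in terms of the rank. *)
Lemma separating_elements_abelian (gT : finGroupType) (p : nat) (G A : {group gT}) :
    prime p -> p.-group G -> A \subset G -> abelian A ->
  exists s : seq gT, [/\ size s <= rk (A / 'Z(G)), {subset s <= G} &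
    {in A, forall x, {in s, forall g, commute x g} -> x \in 'Z(G)}].
Proof.
move=> pr_p pG sAG abA.
have nZA : A \subset 'N('Z(G)) := subset_trans sAG (normal_norm (center_normal G)).
have nAZ : A \subset 'N(A :&: 'Z(G)) by rewrite normsI ?normG.
have cA : [~: A, A] \subset A :&: 'Z(G) by rewrite (commG1P abA) sub1G.
have [V [sVA VP _]] := index_powers p nAZ cA.
have sVG := subset_trans sVA sAG; have nZV := subset_trans sVA nZA.
have iV : #|V : 'Z(G)| <= p ^ rk (A / 'Z(G)).
  rewrite -card_quotient // -indexg1.
  apply: leq_trans (index_rk_exponent pr_p _ (sub1G _) _) _.
  - exact: quotient_abelian (abelianS sVA abA).
  - move=> _ /morphimP[x nZx Vx ->]; rewrite -morphX //= coset_id ?group1 //.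
    by have := VP x (subsetP sVA x Vx); rewrite Vx => /esym/setIP[].
  by rewrite leq_exp2l ?prime_gt1 // rkS // quotientS.
have [s [cs sG sP]] := separating_elements pG sVG iV.
exists s; split=> // x Ax cxs.
(* Descend from a power of x that is trivial, hence central, to x itself. *)
have [j] : exists j, x ^+ (p ^ j) \in 'Z(G).
  exists (logn p #|G|); rewrite -card_pgroup // expg_cardG ?group1 //.
  exact: subsetP sAG x Ax.
elim: j x Ax cxs => [|j IHj] x Ax cxs; first by rewrite expn0 expg1.
rewrite expnS expgM => Zxp; apply: sP => //.
rewrite VP // in_setI groupX //=; apply: IHj => //; first exact: groupX.
by move=> g sg; apply/commute_sym/commuteX/commute_sym/cxs.
Qed.

(** Conjugation by x multiplies a and b by central elements, which does not
change the commutator of a and b. *)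
Lemma commg_central_mod (gT : finGroupType) (G : {group gT}) (x a b : gT) :
    a \in G -> b \in G -> [~ x, a] \in 'Z(G) -> [~ x, b] \in 'Z(G) ->
  commute x [~ a, b].
Proof.
move=> Ga Gb Zxa Zxb; apply/commute_sym/commgP/conjg_fixP.
have [/centerP[Gz cz] /centerP[Gw cw]] : [~ a, x] \in 'Z(G) /\ [~ b, x] \in 'Z(G).
  by rewrite -![[~ _, x] \in _]groupV !invg_comm.
rewrite conjRg (conjg_mulR a) (conjg_mulR b) commMgJ.
have -> : [~ [~ a, x], b * [~ b, x]] = 1 by apply/eqP/commgP/cz; rewrite groupM.
rewrite mulg1 commgMJ.
have -> : [~ a, [~ b, x]] = 1 by apply/eqP/commgP/commute_sym/cw.
have Gab : [~ a, b] \in G by rewrite groupR.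
have fixz z : {in G, forall y, commute z y} -> [~ a, b] ^ z = [~ a, b].
  by move=> cGz; apply/conjg_fixP/commgP/commute_sym/cGz.
by rewrite mul1g !fixz.
Qed.

(** The elements are the entries of commutators that generate G' modulo the
centre; by Burnside's basis theorem, rk (G' / Z) commutators are enough. *)
Lemma centralizing_elements (gT : finGroupType) (p : nat) (G : {group gT}) :
    prime p -> p.-group G ->
  exists s : seq gT, [/\ size s <= 2 * rk (G^`(1) / 'Z(G)), {subset s <= G} &
    {in G, forall x, {in s, forall a, [~ x, a] \in 'Z(G)} -> x \in 'C(G^`(1))}].
Proof.
move=> pr_p pG; set Z := 'Z(G)%G.
have nZG : G \subset 'N(Z) := normal_norm (center_normal G).
have nZX : commg_set G G \subset 'N(Z).
  apply/subsetP=> _ /imset2P[a b Ga Gb ->]; apply: (subsetP nZG).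
  by rewrite groupR.
have nZG' : G^`(1) \subset 'N(Z) by rewrite gen_subG.
have genX : <<commg_set G G / Z>> = G^`(1) / Z by rewrite -quotient_gen.
have pG' : p.-group (G^`(1) / Z) by rewrite quotient_pgroup // (pgroupS (der_sub 1 G)).
have [Y [sYX cY genY]] := Burnside_basis_rk pr_p pG' genX.
have [s [cs sG sP]] : exists s : seq gT,
    [/\ size s = (2 * size (enum Y))%N, {subset s <= G} &
    {in enum Y, forall y, exists a, exists b,
      [/\ a \in s, b \in s & y = coset Z [~ a, b]]}].
  have: {subset enum Y <= commg_set G G / Z}.
    by move=> y; rewrite mem_enum; apply: subsetP.
  elim: (enum Y) => [|y t IHt] sX; first by exists [::].
  have [|s [cs sG sP]] := IHt; first by move=> z tz; rewrite sX // in_cons tz orbT.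
  have /morphimP[_ _ /imset2P[a b Ga Gb ->] Ey] := sX y (mem_head _ _).
  exists [:: a, b & s]; split; first by rewrite /= cs mulnS.
    by move=> c; rewrite !in_cons => /or3P[/eqP-> | /eqP-> | /sG].
  move=> z; rewrite in_cons => /predU1P[-> | /sP[c [d [sc sd ->]]]].
    by exists a, b; rewrite !in_cons !eqxx orbT.
  by exists c, d; rewrite !in_cons sc sd !orbT.
exists s; split=> // [|x Gx cxs]; first by rewrite cs leq_mul // -cardE.
(* 'C_G[x] contains the centre and covers the generators of G' modulo it. *)
have sZC : Z \subset 'C_G[x].
  apply/subsetP=> z /setIP[Gz /centP cz]; apply/setIP; split=> //.
  exact/cent1P/cz.
have: G^`(1) / Z \subset 'C_G[x] / Z.
  rewrite -genY gen_subG; apply/subsetP=> y Yy.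
  have [a [b [sa sb ->]]] := sP y (etrans (mem_enum _ _) Yy).
  have [Ga Gb] := (sG a sa, sG b sb).
  apply: mem_quotient; apply/setIP; split; first by rewrite groupR.
  apply/cent1P/commute_sym/(commg_central_mod Ga Gb); exact: cxs.
rewrite quotientSGK // => /subsetP sGC.
by apply/centP=> c /sGC/setIP[_ /cent1P].
Qed.

(** * Reaching the second centre *)

Lemma commg_cent_der (gT : finGroupType) (G : {group gT}) :
  [~: 'C_G(G^`(1)), G] \subset 'C_G(G^`(1)).
Proof. by rewrite commg_subl normsI ?normG ?norms_cent ?der_norm. Qed.

(** For h in G and g in s, the elements hg and gh differ by an element of G',
with which x and [x, gh] commute, so that [x, hg] = [x, gh].  Expanding both
sides, with [x, g] central, shows that [x, h] commutes with g; as g is arbitrary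
in s, the separating property of s makes [x, h] central. *)
Lemma mem_ucn2 (gT : finGroupType) (G : {group gT}) (x : gT) (s : seq gT) :
    x \in G -> x \in 'C(G^`(1)) -> {subset s <= G} ->
    {in s, forall g, [~ x, g] \in 'Z(G)} ->
    {in [~: 'C_G(G^`(1)), G], forall y, {in s, forall g, commute y g} -> y \in 'Z(G)} ->
  x \in 'Z_2(G).
Proof.
move=> Gx cxG' sG cxs sP; rewrite ucnSnR inE Gx /= ucn1 gen_subG.
apply/subsetP=> _ /imset2P[_ h /set1P-> Gh ->].
have Cx : x \in 'C_G(G^`(1)) by apply/setIP.
have Ay : [~ x, h] \in [~: 'C_G(G^`(1)), G] by apply: mem_commg.
apply: sP => // g sg; have Gg := sG g sg.
have [/centerP[_ cz] cG'] :
    [~ x, g] \in 'Z(G) /\ {in G, forall k, [~ x, k] \in 'C(G^`(1))}.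
  split=> [|k Gk]; first exact: cxs.
  by have /setIP[] := subsetP (commg_cent_der G) _ (mem_commg Cx Gk).
have G'c : [~ h, g] \in G^`(1) by apply: mem_commg.
have Ec : [~ x, h * g] = [~ x, g * h].
  rewrite (commgC h g) commgMJ.
  have -> : [~ x, [~ h, g]] = 1 by apply/eqP/commgP/(centP cxG').
  rewrite mul1g; apply/conjg_fixP/commgP.
  by apply: (centP (cG' _ _)) => //; rewrite groupM.
move: Ec; rewrite !commgMJ.
have -> : [~ x, g] ^ h = [~ x, g] by apply/conjg_fixP/commgP/cz.
rewrite -cz ?groupR // => /mulgI fix_y.
by apply/commgP/conjg_fixP.
Qed.

(** The chain is S >= D >= E >= T, where D centralises G' modulo the centre, E
centralises G', and T lies in the second centre; the costs are
'C(r, 2) + 3r^2, 2r^2 and r^2. *)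
Lemma second_centre_cost (gT : finGroupType) (p : nat) (G S : {group gT}) :
    prime p -> p.-group G -> S \subset G ->
    let r := rk (G^`(1) / 'Z(G)) in
  exists T : {group gT},
    T \subset 'Z_2(G) /\ gen_over ('C(r, 2) + 6 * r ^ 2) T S.
Proof.
move=> pr_p pG sSG r; set Z := 'Z(G)%G.
have nZG : G \subset 'N(Z) := normal_norm (center_normal G).
have nZS := subset_trans sSG nZG; have sG'G : G^`(1) \subset G := der_sub 1 G.
have nZG' := subset_trans sG'G nZG.
have genD : gen_over ('C(r, 2) + 3 * r ^ 2) 'C_(S / Z)(G^`(1) / Z) (S / Z).
  apply: (normal_cost pr_p (quotient_pgroup Z pG) (quotientS Z sSG)).
  exact: quotient_normal (der_normal 1 G).
pose D := (S :&: coset Z @*^-1 'C_(S / Z)(G^`(1) / Z))%G.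
have {}genD : gen_over ('C(r, 2) + 3 * r ^ 2) D S := gen_over_cosetpre nZS genD.
have sDS : D \subset S by apply: subsetIl.
have sDG := subset_trans sDS sSG.
have cDG' : [~: G^`(1), D] \subset Z.
  rewrite commGC -quotient_cents2 ?(subset_trans sDG) //.
  have sDD : D / Z \subset 'C_(S / Z)(G^`(1) / Z).
    by rewrite sub_quotient_pre ?subsetIr // (subset_trans sDG).
  by rewrite (subset_trans sDD) ?subsetIr.
have [s [cs sG sP]] := centralizing_elements pr_p pG.
have [|E [sED genE _ cEs]] := @comm_steps _ D G^`(1)%G Z s nZG' cDG'.
  by move=> x a Dx /sG Ga; apply: mem_commg => //; apply: subsetP Dx.
have sEG := subset_trans sED sDG.
have cEG' : E \subset 'C(G^`(1)).
  by apply/subsetP=> x Ex; apply: sP => [|a sa]; [apply: subsetP Ex | apply: cEs].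
pose A := [~: 'C_G(G^`(1)), G]%G.
have sAG' : A \subset G^`(1) by rewrite commSg ?subsetIl.
have abA : abelian A.
  rewrite /abelian (subset_trans sAG') // centsC.
  by rewrite (subset_trans (commg_cent_der G)) ?subsetIr.
have sAG := subset_trans sAG' sG'G.
have [t [ct tG tP]] := separating_elements_abelian pr_p pG sAG abA.
have [||T [sTE genT _ cTt]] := @comm_steps _ E A Z t (subset_trans sAG' nZG').
- apply: subset_trans (sub1G Z); apply/trivgP/commG1P.
  by rewrite (subset_trans sAG') // centsC.
- move=> x g Ex /tG Gg; apply: mem_commg => //.
  by rewrite inE (subsetP sEG) ?(subsetP cEG').
exists T; split.
  apply/subsetP=> x Tx; have Ex := subsetP sTE x Tx.
  apply: (mem_ucn2 (s := t)) => //; first exact: subsetP Ex.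
  - exact: subsetP Ex.
  - by move=> g tg; apply: cTt.
have leA : rk (A / Z) <= r by rewrite rkS // quotientS.
have {}genT : gen_over (r ^ 2) T E.
  by apply: gen_over_leq genT; rewrite -mulnn leq_mul // (leq_trans ct).
have {}genE : gen_over (2 * r ^ 2) E D.
  by apply: gen_over_leq genE; rewrite -mulnn mulnA leq_mul.
apply: gen_over_leq (gen_over_trans genT (gen_over_trans genE genD)).
by rewrite (addnCA (2 * _)%N) addnCA leq_add2l -{1}(mul1n (r ^ 2)%N) -!mulnDl.
Qed.

Lemma rk_mod_second_centre (gT : finGroupType) (p : nat) (G : {group gT}) :
    prime p -> p.-group G ->
  rk (G / 'Z_2(G)) <=
    'C(rk (G^`(1) / 'Z(G)), 2) + 6 * rk (G^`(1) / 'Z(G)) ^ 2.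
Proof.
move=> pr_p pG; apply/rk_leP=> K sKG.
have nZG : G \subset 'N('Z_2(G)) := normal_norm (ucn_normal 2 G).
pose S := (G :&: coset 'Z_2(G) @*^-1 K)%G.
have sSG : S \subset G by apply: subsetIl.
have eSK : S / 'Z_2(G) = K by rewrite /quotient morphim_setIpre; apply/setIidPr.
have [T [sTZ [B cB gB]]] := second_centre_cost pr_p pG sSG.
have sBS : B \subset S by rewrite -gB joing_subr.
have nZS := subset_trans sSG nZG.
exists (B / 'Z_2(G)); last first.
  apply: leq_trans cB; rewrite /quotient morphimEsub ?leq_imset_card //.
  exact: subset_trans sBS nZS.
have sTS : T \subset S by rewrite -gB joing_subl.
rewrite -eSK -[in RHS]gB quotientY ?(subset_trans sBS) ?(subset_trans sTS) //.
by rewrite (quotientS1 sTZ) -[RHS]joing_idr joing1G.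
Qed.

Lemma double_bin2 n : (2 * 'C(n, 2) + n = n ^ 2)%N.
Proof.
by elim: n => // n IHn; rewrite binS bin1; lia.
Qed.

Theorem theorem7 (p : nat) (gT : finGroupType) (G : {group gT}) (r : nat)
    (hp : prime p) (hG : (p.-group G)%g)
    (hr : r = rk (G^`(1) / (G^`(1) :&: 'Z(G)))%g) :
  ((rk (G / 'Z_2(G))%g)%:R <=
     2%:R^-1 * (13%:R * r%:R ^+ 2 - r%:R) :> rat)%R.
Proof.
have nZG' : G^`(1) \subset 'N('Z(G)).
  exact: subset_trans (der_sub 1 G) (normal_norm (center_normal G)).
have le_r : rk (G^`(1) / 'Z(G)) <= r.
  have /isogP[f _ <-] := second_isog nZG'.
  by rewrite hr [_ :&: 'Z(G)]setIC rk_morphim.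
have le_n : rk (G / 'Z_2(G)) <= 'C(r, 2) + 6 * (r ^ 2)%N.
  apply: leq_trans (rk_mod_second_centre hp hG) _.
  apply: leq_add; first exact: leq_bin2l.
  by rewrite -!mulnn !leq_mul.
have le_2n : (2 * rk (G / 'Z_2(G))%g + r <= 13 * r ^ 2)%N.
  by have := double_bin2 r; lia.
rewrite ler_pdivlMl ?ltr0n // lerBrDr -natrX -!natrM -natrD ler_nat.
exact: le_2n.
Qed.
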